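(* Let $\widetilde{\mathcal M}_1$ be the space of nonzero finite integrable Borel measures on the kale $\mathcal K$ modulo positive scaling, with the Wasserstein topology, and let $\mathcal S\subset\widetilde{\mathcal M}_1$ be the (open) subset of fully sticky measures. A measure $\mu\in\widetilde{\mathcal M}_1$ is (1) fully sticky (i.e. $\mu\in\mathcal S$) if and only if there is an open neighborhood of $\mu$ such that all measures in that neighborhood have the same mean as $\mu$. Equivalently, $\mu$ is fully sticky if and only if all directions $\nu\in\widetilde{\mathcal M}_1$ are sticky for $\mu$. (2) partly sticky if and only if $\mu\in\partial\mathcal S$, the topological boundary of $\mathcal S$. Equivalently, $\mu$ is partly sticky if and only if every open neighborhood of $\mu$ contains nonempty open sets $U$ and $V$ such that every $\nu\in V$ has the same mean as $\mu$ and every $\nu\in U$ has a mean different from that of $\mu$. (3) nonsticky if and only if $\mu\in\widetilde{\mathcal M}_1\setminus\overline{\mathcal S}$, the complement of the closure of $\mathcal S$. Equivalently, $\mu$ is nonsticky if and only if no open neighborhood of $\mu$ contains a nonempty open set $U$ consisting of measures with the same mean as $\mu$.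
   Context: Fix $\alpha>2\pi$. The kale is $\mathcal K=\big((0,\infty)\times(\mathbb R/\alpha\mathbb Z)\big)\cup\{\mathbf 0\}$; points are written $(r,\theta)$ with $r\ge 0$, $\theta\in\mathbb R/\alpha\mathbb Z$, and $(0,\theta)=\mathbf 0$ for every $\theta$. For angles put $|\theta'-\theta|=\min_{n\in\mathbb Z}|n\alpha+\theta'-\theta|$; when $|\theta'-\theta|\le\pi$, the symbol $\theta'-\theta$ denotes the unique representative in $[-\pi,\pi]$. The metric is $d((r_1,\theta_1),(r_2,\theta_2))^2=(r_1+r_2)^2$ if $|\theta_1-\theta_2|\ge\pi$ and $=r_1^2+r_2^2-2r_1r_2\cos|\theta_1-\theta_2|$ if $|\theta_1-\theta_2|\le\pi$; in particular $d(\mathbf 0,(r,\theta))=r$. Folding map: $F_\theta:\mathcal K\to\mathbb R^2$ sends $\mathbf 0$ to $0$ and, in polar coordinates on $\mathbb R^2$, $F_\theta(r',\theta')=(r',\theta'-\theta)$ if $r'>0$, $|\theta'-\theta|\le\pi$, and $F_\theta(r',\theta')=(r',\pi)$ if $r'>0$, $|\theta'-\theta|\ge\pi$. $\mathcal M_1$ is the set of nonzero finite Borel measures $\mu$ on $\mathcal K$ with $\int d(\mathbf 0,p)\,d\mu(p)<\infty$. Two measures in $\mathcal M_1$ are equivalent if they differ by a constant factor $c>0$; $\widetilde{\mathcal M}_1$ is the set of equivalence classes. The distance between two classes is $\rho(\mu,\nu)=\sup_f\big(\int f\,d\mu-\int f\,d\nu\big)$, where $\mu,\nu$ are the representatives with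 total mass $1$ and $f$ ranges over real functions on $\mathcal K$ with Lipschitz constant $1$; this gives the topology of $\widetilde{\mathcal M}_1$. For a probability measure $\mu\in\mathcal M_1$ let $m_\theta=\int_{\mathcal K}F_\theta(p)\,d\mu(p)=(m_{\theta,1},m_{\theta,2})\in\mathbb R^2$ (cartesian coordinates) and $K=\{\theta: m_{\theta,1}\ge 0\}$. Then $\mu$ is fully sticky if $K=\emptyset$; partly sticky if $K\neq\emptyset$ and $m_{\theta,1}=0$ for all $\theta\in K$; nonsticky if $K$ has non-empty interior and $m_{\theta,1}>0$ on $\mathrm{int}(K)$. The mean of $\mu$ is $\mathbf 0$ if $\mu$ is fully or partly sticky, and is $(m_{\theta',1},\theta')$ if $\mu$ is nonsticky, where $\theta'$ is the (unique) maximizer of $\theta\mapsto m_{\theta,1}$. For a general element of $\mathcal M_1$ or a class in $\widetilde{\mathcal M}_1$, these notions refer to its normalization to total mass $1$. For $\mu,\nu\in\mathcal M_1$: $\nu$ is a sticky direction for $\mu$ if $\mu$ and $\mu+\epsilon\nu$ have the same mean for all sufficiently small $\epsilon>0$. (This depends only on the classes of $\mu$ and $\nu$.) *)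

(* Defs.v *)
From HB Require Import structures.
From mathcomp Require Import all_boot all_order all_algebra generic_quotient.
From mathcomp Require Import all_classical all_reals all_analysis.

Set Implicit Arguments.
Unset Strict Implicit.
Unset Printing Implicit Defensive.
Import Order.TTheory GRing.Theory Num.Theory.
Import numFieldNormedType.Exports.
Local Open Scope classical_set_scope.
Local Open Scope ring_scope.
Local Open Scope quotient_scope.

Section MetricTopology.
Context {R : realType} {T : Type} (d : T -> T -> \bar R).

Definition metric_open (A : set T) : Prop :=
  forall x, A x -> exists2 e : R, 0 < e & [set y | (d x y < e%:E)%E] `<=` A.

Lemma metric_openT : metric_open setT.
Proof. by move=> x _; exists 1. Qed.

Lemma metric_openI : setI_closed metric_open.
Proof.
move=> A B oA oB x [/oA[e e0 eA] /oB[f f0 fB]].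
exists (Num.min e f); first by rewrite lt_min e0.
move=> y /= dxy; split.
  by apply: eA => /=; apply: (lt_le_trans dxy); rewrite lee_fin ge_min lexx.
by apply: fB => /=; apply: (lt_le_trans dxy); rewrite lee_fin ge_min lexx orbT.
Qed.

Lemma metric_open_bigU (I : Type) (F : I -> set T) :
  (forall i, metric_open (F i)) -> metric_open (\bigcup_i F i).
Proof.
move=> oF x [i _ /oF[e e0 eF]]; exists e => // y dxy.
by exists i => //; exact: eF.
Qed.

End MetricTopology.

Section Circle.
Context {R : realType} (alpha : R).

Definition angle_equiv (x y : R) : bool :=
  `[< exists n : int, x - y = n%:~R * alpha >].

Lemma angle_equiv_refl : reflexive angle_equiv.
Proof. by move=> x; apply/asboolP; exists 0; rewrite subrr mul0r. Qed.

Lemma angle_equiv_sym : symmetric angle_equiv.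
Proof.
suff h x y : angle_equiv x y -> angle_equiv y x.
  by move=> x y; apply/idP/idP; exact: h.
move=> /asboolP[n xy]; apply/asboolP; exists (- n).
by rewrite -opprB xy mulrNz mulNr.
Qed.

Lemma angle_equiv_trans : transitive angle_equiv.
Proof.
move=> y x z /asboolP[n xy] /asboolP[m yz]; apply/asboolP; exists (n + m).
by rewrite -(subrKA y) xy yz mulrzDr mulrDl.
Qed.

Canonical angle_equiv_equiv :=
  EquivRel angle_equiv angle_equiv_refl angle_equiv_sym angle_equiv_trans.

Definition circle : Type := quotient_topology {eq_quot angle_equiv}.

HB.instance Definition _ := PointedTopological.on circle.
HB.instance Definition _ := Quotient.on circle.

Implicit Types s t : circle.

(* |t - s|; the minimum over n is written as an infimum. *)
Definition angle_dist s t : R :=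
  inf (range (fun n : int => `|n%:~R * alpha + (repr t - repr s)|)).

(* The representative in [-pi, pi] of t - s; meaningful if
   angle_dist s t <= pi. *)
Definition angle_sub t s : R :=
  xget 0 [set x | - pi <= x <= pi /\
                  exists n : int, x = n%:~R * alpha + (repr t - repr s)].

End Circle.

Section Kale.
Context {R : realType} (alpha : R).

Variant kale : Type :=
  | origin
  | kale_pt (r : R) & 0 < r & circle alpha.

HB.instance Definition _ := gen_eqMixin kale.
HB.instance Definition _ := gen_choiceMixin kale.
HB.instance Definition _ := isPointed.Build kale origin.

(* The point (r, t); every (0, t) is the origin. *)
Definition polar (r : R) (t : circle alpha) : kale :=
  if @idP (0 < r) is ReflectT r_gt0 then kale_pt r_gt0 t else origin.

Definition radius (p : kale) : R := if p is @kale_pt r _ _ then r else 0.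

Definition kale_dist (p q : kale) : R :=
  match p, q with
  | @kale_pt r1 _ t1, @kale_pt r2 _ t2 =>
      if pi <= angle_dist t1 t2 then r1 + r2
      else Num.sqrt (r1 ^+ 2 + r2 ^+ 2
                     - 2 * r1 * r2 * cos (angle_dist t1 t2))
  | _, _ => radius p + radius q
  end.

Definition kale_edist (p q : kale) : \bar R := (kale_dist p q)%:E.

HB.instance Definition _ := isOpenTopological.Build kale
  (metric_openT kale_edist) (metric_openI (d := kale_edist))
  (metric_open_bigU (d := kale_edist)).

HB.instance Definition _ :=
  Measurable.copy kale (g_sigma_algebraType (@open kale)).

Definition folding (t : circle alpha) (p : kale) : R * R :=
  match p with
  | origin => (0, 0)
  | @kale_pt r _ s =>
      if angle_dist t s <= pi
      then (r * cos (angle_sub s t), r * sin (angle_sub s t))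
      else (r * cos pi, r * sin pi)
  end.

Definition lipschitz1 (f : kale -> R) : Prop :=
  forall p q, `|f p - f q| <= kale_dist p q.

End Kale.

Arguments origin {R alpha}.

Section Means.
Context {R : realType} {alpha : R}.
Implicit Types (P Q : probability (kale alpha) R).
Implicit Types (mu nu : {measure set (kale alpha) -> \bar R}).

Definition folded_mean P (t : circle alpha) : R * R :=
  (\int[P]_p (folding t p).1, \int[P]_p (folding t p).2).

Definition sticky_set P : set (circle alpha) :=
  [set t | 0 <= (folded_mean P t).1].

Definition fully_sticky P : Prop := sticky_set P = set0.

Definition partly_sticky P : Prop :=
  sticky_set P !=set0 /\
  forall t, sticky_set P t -> (folded_mean P t).1 = 0.

Definition nonsticky P : Prop :=
  (sticky_set P)° !=set0 /\
  forall t, (sticky_set P)° t -> 0 < (folded_mean P t).1.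

(* In the nonsticky case the maximizer of the first coordinate is unique. *)
Definition mean P : kale alpha :=
  if `[< nonsticky P >] then
    let t := [get t | forall s, (folded_mean P s).1 <= (folded_mean P t).1] in
    polar (folded_mean P t).1 t
  else origin.

Definition rho P Q : \bar R :=
  ereal_sup [set (\int[P]_p (f p)%:E - \int[Q]_p (f p)%:E)%E
            | f in @lipschitz1 R alpha].

(* The default value of mnormalize is used only for measures of total mass 0
   or +oo. *)
Definition normalize mu : probability (kale alpha) R :=
  mnormalize mu (dirac (origin : kale alpha)).

Definition sticky_direction mu nu : Prop :=
  exists2 e0 : R, 0 < e0 &
    forall e : {nonneg R}, 0 < e%:num < e0 ->
      mean (normalize mu) = mean (normalize (measure_add mu (mscale e nu))).

End Means.

Section MeasureClasses.
Context {R : realType} (alpha : R).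

Record M1 : Type := mkM1 {
  M1_measure :> {finite_measure set (kale alpha) -> \bar R};
  M1_neq0 : M1_measure setT != 0%E;
  M1_integrable : (\int[M1_measure]_p (kale_dist origin p)%:E < +oo)%E }.

HB.instance Definition _ := gen_eqMixin M1.
HB.instance Definition _ := gen_choiceMixin M1.

Definition M1_equiv (mu nu : M1) : bool :=
  `[< exists2 c : R, 0 < c &
      forall A, measurable A -> mu A = (c%:E * nu A)%E >].

Lemma M1_equiv_refl : reflexive M1_equiv.
Proof. by move=> mu; apply/asboolP; exists 1 => // A _; rewrite mul1e. Qed.

Lemma M1_equiv_sym : symmetric M1_equiv.
Proof.
suff h mu nu : M1_equiv mu nu -> M1_equiv nu mu.
  by move=> mu nu; apply/idP/idP; exact: h.
move=> /asboolP[c c0 munu]; apply/asboolP; exists c^-1; first by rewrite invr_gt0.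
by move=> A mA; rewrite munu// muleA -EFinM mulVf ?gt_eqF// mul1e.
Qed.

Lemma M1_equiv_trans : transitive M1_equiv.
Proof.
move=> nu mu la /asboolP[c c0 munu] /asboolP[c' c'0 nula].
apply/asboolP; exists (c * c'); first exact: mulr_gt0.
by move=> A mA; rewrite munu// nula// muleA EFinM.
Qed.

Canonical M1_equiv_equiv :=
  EquivRel M1_equiv M1_equiv_refl M1_equiv_sym M1_equiv_trans.

Definition M1_class : Type := {eq_quot M1_equiv}.

HB.instance Definition _ := Quotient.on M1_class.
HB.instance Definition _ := Choice.on M1_class.

Definition unit_mass (x : M1_class) : probability (kale alpha) R :=
  normalize (repr x).

Lemma normalize_M1E (mu : M1) (A : set (kale alpha)) :
  normalize mu A = (mu A * (fine (mu setT))^-1%:E)%E.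
Proof.
rewrite /= /mnormalize (negbTE (M1_neq0 mu)) /=.
by rewrite (negbTE (_ : mu setT != +oo%E))// -ltey ltey_eq fin_num_measure.
Qed.

Lemma unit_massE (mu : M1) (A : set (kale alpha)) :
  measurable A -> unit_mass (\pi mu) A = normalize mu A.
Proof.
move=> mA; rewrite /unit_mass !normalize_M1E.
have /asboolP[c c0 cE] : M1_equiv (repr (\pi_M1_class mu)) mu.
  by apply/eqmodP; rewrite reprK.
rewrite !cE// -(fineK (fin_num_measure mu _ mA)).
rewrite -(fineK (fin_num_measure mu _ measurableT)).
by rewrite -!EFinM /= invfM mulrACA divff ?gt_eqF// mul1r.
Qed.

Definition class_dist (x y : M1_class) : \bar R :=
  rho (unit_mass x) (unit_mass y).

HB.instance Definition _ := isOpenTopological.Build M1_class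
  (metric_openT class_dist) (metric_openI (d := class_dist))
  (metric_open_bigU (d := class_dist)).

Definition fully_sticky_classes : set M1_class :=
  [set x | fully_sticky (unit_mass x)].

Definition class_mean (x : M1_class) : kale alpha := mean (unit_mass x).

Definition class_sticky_direction (x y : M1_class) : Prop :=
  sticky_direction (repr x) (repr y).

End MeasureClasses.

Definition boundary {T : topologicalType} (A : set T) : set T :=
  closure A `\` A°.

(* Main.v *)
(** For a unit mass [x] and a direction [t], let [pull x t] be the first
    coordinate of the folded mean, i.e. the integral of
    [r * cos (min (dist t s) pi)] over points [(r, s)], and let [peak x] be its
    maximum over [t].  The integrand is 1-Lipschitz on the kale, so [peak] is
    1-Lipschitz for the Wasserstein distance.  Since [alpha > 2 pi], the function
    [r * pull x t] is concave on the kale; hence a direction interior to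
    [{t | 0 <= pull x t}] has positive pull as soon as some direction has.  So
    fully sticky, partly sticky and nonsticky mean [peak x < 0], [= 0], [> 0],
    and the radius of the mean is [max 0 (peak x)].  The theorem then follows by
    adding small masses: four equally spaced unit masses lower the peak from 0
    to a negative value, one mass in a maximizing direction raises it from 0,
    and a mass at the origin scales down a positive peak. *)
Require Import Defs.
From HB Require Import structures.
From mathcomp Require Import all_boot all_order all_algebra.
From mathcomp Require Import all_classical all_reals all_analysis.
From mathcomp Require Import measurable_realfun zify ring lra.
Set Implicit Arguments.
Unset Strict Implicit.
Unset Printing Implicit Defensive.
Import Order.TTheory GRing.Theory Num.Theory.
Import numFieldNormedType.Exports.
Local Open Scope classical_set_scope.
Local Open Scope ring_scope.

(** * The cosine clipped at pi *)

Section ClippedCosine.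
Context {R : realType}.
Implicit Types a b x y : R.

Definition clipped_cos x : R := cos (Num.min x pi).

Lemma clipped_cos_le1 x : clipped_cos x <= 1.
Proof. exact: cos_le1. Qed.

Lemma clipped_cos_norm x : `|clipped_cos x| <= 1.
Proof. exact: cos_max. Qed.

Lemma clipped_cosE x : x <= pi -> clipped_cos x = cos x.
Proof. by move=> xpi; rewrite /clipped_cos min_l. Qed.

Lemma clipped_cos_pi x : pi <= x -> clipped_cos x = -1.
Proof. by move=> pix; rewrite /clipped_cos min_r// cospi. Qed.

Lemma le_cos_0pi x y : 0 <= x -> x <= y -> y <= pi -> cos y <= cos x.
Proof.
move=> x0 xy ypi; have y0 := le_trans x0 xy; have xpi := le_trans xy ypi.
by rewrite leNgt ltr_cos ?in_itv/= ?x0 ?y0 ?xpi// -leNgt.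
Qed.

Lemma lt_cos_0pi x y : 0 <= x -> x < y -> y <= pi -> cos y < cos x.
Proof.
move=> x0 xy ypi; have y0 := le_trans x0 (ltW xy).
have xpi := le_trans (ltW xy) ypi.
by rewrite ltr_cos ?in_itv/= ?x0 ?y0 ?xpi.
Qed.

Lemma clipped_cos_le x y : 0 <= x -> x <= y -> clipped_cos y <= clipped_cos x.
Proof.
move=> x0 xy; apply: le_cos_0pi; first by rewrite le_min x0 pi_ge0.
  by rewrite le_min !ge_min xy lexx orbT.
by rewrite ge_min lexx orbT.
Qed.

Lemma clipped_cos_lt x y :
  0 <= x -> x < pi -> x < y -> clipped_cos y < clipped_cos x.
Proof.
move=> x0 xpi xy; apply: lt_cos_0pi; first by rewrite le_min x0 pi_ge0.
  by rewrite (min_l (ltW xpi)) lt_min xy.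
by rewrite ge_min lexx orbT.
Qed.

Lemma clipped_cos_piB x : 0 <= x -> x <= pi -> clipped_cos (pi - x) = - cos x.
Proof.
move=> x0 xpi; rewrite clipped_cosE; last by rewrite gerBl.
by rewrite cosB cospi sinpi mul0r addr0 mulN1r.
Qed.

(** As [clipped_cos] decreases on nonnegative reals, [y >= pi - x] forces
    [clipped_cos y <= - cos x]. *)
Lemma clipped_cosD_le0 x y : 0 <= x -> 0 <= y -> pi <= x + y ->
  clipped_cos x + clipped_cos y <= 0.
Proof.
move=> x0 y0 xy; have [xpi|/ltW pix] := leP x pi; last first.
  by rewrite (clipped_cos_pi pix); have := clipped_cos_le1 y; lra.
have : clipped_cos y <= clipped_cos (pi - x) by apply: clipped_cos_le; lra.
by rewrite clipped_cos_piB// (clipped_cosE xpi); lra.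
Qed.

Lemma clipped_cosD_lt0 x y : 0 < x -> 0 < y -> pi < x + y ->
  clipped_cos x + clipped_cos y < 0.
Proof.
move=> x0 y0 xy; have pi0 := pi_gt0 R; have [xpi|/ltW pix] := leP x pi; last first.
  rewrite (clipped_cos_pi pix); have := @clipped_cos_lt 0 y (lexx 0) pi0 y0.
  have := clipped_cos_le1 0; lra.
have : clipped_cos y < clipped_cos (pi - x) by apply: clipped_cos_lt; lra.
by rewrite clipped_cos_piB ?(ltW x0)// (clipped_cosE xpi); lra.
Qed.

(** Meant for the distances [a], [a'] and [b], [b'] from one direction to two antipodal pairs. Each
    pair contributes at most 0, and strictly less when both its distances are positive; the mixed
    sums being positive, at most one pair contains a zero. *)
Lemma clipped_cos4_lt0 a a' b b' :
    0 <= a -> 0 <= a' -> 0 <= b -> 0 <= b' -> pi < a + a' -> pi < b + b' ->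
    0 < a + b -> 0 < a + b' -> 0 < b + a' -> 0 < b' + a' ->
  clipped_cos a + clipped_cos a' + clipped_cos b + clipped_cos b' < 0.
Proof.
move=> a0 a'0 b0 b'0 aa' bb' ab ab' ba' b'a'.
have := clipped_cosD_le0 a0 a'0 (ltW aa').
have := clipped_cosD_le0 b0 b'0 (ltW bb').
have [ale|agt] := leP a 0.
  have : clipped_cos b + clipped_cos b' < 0 by apply: clipped_cosD_lt0; lra.
  lra.
have [a'le|a'gt] := leP a' 0.
  have : clipped_cos b + clipped_cos b' < 0 by apply: clipped_cosD_lt0; lra.
  lra.
have := clipped_cosD_lt0 agt a'gt aa'; lra.
Qed.

Lemma cos_lip x y : `|cos x - cos y| <= `|x - y|.
Proof.
wlog xy : x y / x <= y => [h|].
  by have [/h //|/ltW/h] := leP x y; rewrite distrC (distrC y).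
have [c _ E] : exists2 c, c \in `[x, y]%R & cos y - cos x = - sin c * (y - x).
  apply: MVT_segment => //.
  by apply: continuous_subspaceT => z; exact: continuous_cos.
by rewrite distrC (distrC x) E normrM normrN ler_piMl// sin_max.
Qed.

Lemma min_lip c x y : `|Num.min x c - Num.min y c| <= `|x - y|.
Proof.
wlog xy : x y / x <= y => [h|].
  by have [/h //|/ltW/h] := leP x y; rewrite distrC (distrC y).
rewrite distrC (distrC x) !ger0_norm ?subr_ge0//.
  by rewrite /Num.min; case: ifPn; case: ifPn; rewrite -?leNgt; lra.
by rewrite le_min !ge_min xy lexx orbT.
Qed.

Lemma clipped_cos_lip x y : `|clipped_cos x - clipped_cos y| <= `|x - y|.
Proof. exact: le_trans (cos_lip _ _) (min_lip _ _ _). Qed.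

End ClippedCosine.

(** * Distance to the nearest multiple of [alpha] *)

Section ArcLength.
Context {R : realType} (alpha : R).
Hypothesis alpha_gt0 : 0 < alpha.
Implicit Types (x y : R) (n : int).

(** [angle_dist s t] is convertible to [arc_length (repr t - repr s)]; angles are thus treated as
    real numbers. *)
Definition arc_length x : R :=
  inf (range (fun n : int => `|n%:~R * alpha + x|)).

Lemma arc_length_le x n : arc_length x <= `|n%:~R * alpha + x|.
Proof. by apply: ge_inf; [exists 0 => _ [m _ <-]|exists n]. Qed.

Lemma arc_length_le_norm x : arc_length x <= `|x|.
Proof. by have := arc_length_le x 0; rewrite mul0r add0r. Qed.

Lemma arc_length_ge0 x : 0 <= arc_length x.
Proof.
by apply: lb_le_inf; [exists `|0%:~R * alpha + x|, 0|move=> _ [m _ <-]].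
Qed.

Lemma arc_length_shift x n : arc_length (n%:~R * alpha + x) = arc_length x.
Proof.
rewrite /arc_length; congr inf; apply/seteqP; split=> _ [m _ <-].
  by exists (m + n) => //; rewrite intrD mulrDl addrA.
by exists (m - n) => //; rewrite addrA -mulrDl -intrD subrK.
Qed.

Lemma arc_lengthN x : arc_length (- x) = arc_length x.
Proof.
rewrite /arc_length; congr inf; apply/seteqP; split=> _ [m _ <-];
  by exists (- m) => //; rewrite mulrNz mulNr -?opprD ?normrN// -normrN opprD !opprK.
Qed.

Lemma le_norm_mulz n : n != 0 -> alpha <= `|n%:~R * alpha|.
Proof.
move=> n0; rewrite normrM (gtr0_norm alpha_gt0) ler_peMl ?(ltW alpha_gt0)//.
have : (1 <= `|n|)%R by lia.
by rewrite -(ler_int R) intr_norm.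
Qed.

(** A nonzero multiple of [alpha] has size at least [alpha], so shifting [x] by it leaves at least
    [alpha / 2]. *)
Lemma arc_length_small x : `|x| <= alpha / 2 -> arc_length x = `|x|.
Proof.
move=> xa; apply/eqP; rewrite eq_le arc_length_le_norm /=.
apply: lb_le_inf; first by exists `|0%:~R * alpha + x|, 0.
move=> _ [m _ <-]; have [->|m0] := eqVneq m 0; first by rewrite mul0r add0r.
have := le_norm_mulz m0.
have := ler_normB (m%:~R * alpha + x) x; rewrite addrK; lra.
Qed.

(** The infimum is attained, so later proofs can work with a shortest real representative of an
    angle. *)
Lemma arc_length_lift x :
  exists n, arc_length x = `|n%:~R * alpha + x| /\ `|n%:~R * alpha + x| <= alpha / 2.
Proof.
pose q := x / alpha; have xE : x = q * alpha by rewrite divfK// gt_eqF.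
(* [m] is [x / alpha] rounded to a nearest integer. *)
pose m := Num.floor (q + 1 / 2); pose n : int := - m.
have h : `|n%:~R * alpha + x| <= alpha / 2.
  have /andP[] := floor_itv (q + 1 / 2); rewrite -/m intrD => h1 h2.
  have h3 : 0 <= (q + 1 / 2 - m%:~R) * alpha.
    by rewrite mulr_ge0 ?subr_ge0// ltW.
  have h4 : 0 <= (m%:~R + 1%:~R - (q + 1 / 2)) * alpha.
    by rewrite mulr_ge0 ?subr_ge0 ?ltW.
  by rewrite /n mulrNz xE ler_norml; apply/andP; split; lra.
by exists n; split=> //; rewrite -arc_length_small ?arc_length_shift.
Qed.

Lemma arc_lengthD x y : arc_length (x + y) <= arc_length x + arc_length y.
Proof.
have [n [-> _]] := arc_length_lift x; have [m [-> _]] := arc_length_lift y.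
apply: (le_trans (arc_length_le _ (n + m))); rewrite intrD mulrDl addrACA.
exact: ler_normD.
Qed.

Hypothesis alpha_gt2pi : 2 * pi < alpha.

(** For [|x| <= pi] both sides agree. Beyond [pi] the cosine climbs back as [cos (2 * pi - |x|)],
    while the arc, being [|x|] or at least [alpha - |x|], is no shorter than [2 * pi - |x|]. *)
Lemma clipped_cos_arc_le_cos x :
  `|x| <= 2 * pi -> clipped_cos (arc_length x) <= cos x.
Proof.
move=> x2; have [xpi|/ltW pix] := leP `|x| pi.
  have xa : `|x| <= alpha / 2.
    by move: alpha_gt2pi; lra.
  by rewrite arc_length_small ?clipped_cosE ?cos_norm.
have : 2 * pi - `|x| <= arc_length x.
  have [n [-> _]] := arc_length_lift x; have [->|n0] := eqVneq n 0.
    by rewrite mul0r add0r; lra.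
  have := le_norm_mulz n0; have := alpha_gt2pi.
  have := ler_normB (n%:~R * alpha + x) x; rewrite addrK; lra.
move/(clipped_cos_le _) => /(_ _)/le_trans; apply; first lra.
rewrite clipped_cosE; last lra.
by rewrite -(cos_norm x) mulr_natl cosB cos2pi sin2pi mul1r mul0r addr0.
Qed.

(* As a function on a cone with total angle alpha, [r * clipped_cos] is concave
   along the segment joining two rays at angle [a + b < pi]. *)
Lemma clipped_cos_arc_concave x a b : 0 < a -> 0 < b -> a + b < pi ->
  sin a * clipped_cos (arc_length (x - b)) + sin b * clipped_cos (arc_length (x + a))
  <= sin (a + b) * clipped_cos (arc_length x).
Proof.
move=> a0 b0 abpi.
have sa : 0 < sin a by apply: sin_gt0_pi; lra.
have sb : 0 < sin b by apply: sin_gt0_pi; lra.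
have [n [xE _]] := arc_length_lift x; set z := _ + x in xE.
rewrite -(arc_length_shift (x - b) n) -(arc_length_shift (x + a) n) xE !addrA -/z.
(* In the unclipped range the cosine itself satisfies the relation with equality, and the clipped
   cosine lies below it at [z - b] and [z + a]. *)
have [zpi|/ltW piz] := leP `|z| pi.
  have h y : `|y| <= pi -> clipped_cos (arc_length (z + y)) <= cos (z + y).
    by move=> ypi; apply: clipped_cos_arc_le_cos; have := ler_normD z y; lra.
  have ha : clipped_cos (arc_length (z + a)) <= cos (z + a).
    by apply: h; rewrite gtr0_norm//; lra.
  have hb : clipped_cos (arc_length (z - b)) <= cos (z - b).
    by apply: h; rewrite normrN gtr0_norm//; lra.
  rewrite (clipped_cosE zpi) cos_norm.
  apply: (@le_trans _ _ (sin a * cos (z - b) + sin b * cos (z + a))).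
    by apply: lerD; rewrite ler_pM2l.
  by rewrite sinD cosB cosD; lra.
(* In the clipped range the right side is [- sin (a + b)]. A point at distance [|y|] from [z] still
   has arc length at least [pi - |y|]. *)
have h y : 0 < `|y| < pi -> clipped_cos (arc_length (z + y)) <= - cos y.
  move=> /andP[y0 ypi]; rewrite -(cos_norm y) -clipped_cos_piB ?(ltW y0) ?(ltW ypi)//.
  apply: clipped_cos_le; first lra.
  have := arc_lengthD (z + y) (- y); rewrite addrK arc_lengthN.
  rewrite arc_length_shift xE; have := arc_length_le_norm y; lra.
have ha : clipped_cos (arc_length (z + a)) <= - cos a.
  by apply: h; rewrite gtr0_norm//; lra.
have hb : clipped_cos (arc_length (z - b)) <= - cos b.
  by rewrite -(cosN b); apply: h; rewrite normrN gtr0_norm//; lra.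
rewrite (clipped_cos_pi piz).
apply: (@le_trans _ _ (sin a * - cos b + sin b * - cos a)).
  by apply: lerD; rewrite ler_pM2l.
by rewrite sinD; lra.
Qed.

End ArcLength.

(** * Angles on the circle of length [alpha] *)

Section Circle.
Context {R : realType} (alpha : R).
Hypothesis alpha_gt2pi : 2 * pi < alpha.
Local Open Scope quotient_scope.
Implicit Types s t u : circle alpha.

Let alpha_gt0 : 0 < alpha.
Proof. by move: alpha_gt2pi (pi_gt0 R); lra. Qed.

Lemma repr_circle (x : R) :
  exists n : int, repr (\pi_(circle alpha) x) = n%:~R * alpha + x.
Proof.
have /asboolP[n xE] : angle_equiv alpha (repr (\pi_(circle alpha) x)) x.
  by apply/eqmodP; rewrite reprK.
by exists n; rewrite -xE subrK.
Qed.

Lemma angle_dist_pi x y :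
  angle_dist (\pi_(circle alpha) x) (\pi_(circle alpha) y) =
  arc_length alpha (y - x).
Proof.
have [n xE] := repr_circle x; have [m yE] := repr_circle y.
rewrite -[LHS]/(arc_length alpha _) xE yE -(arc_length_shift alpha (y - x) (m - n)).
by congr arc_length; rewrite intrD mulrDl mulrNz mulNr; ring.
Qed.

Lemma angle_distC s t : angle_dist s t = angle_dist t s.
Proof. by rewrite -[LHS](arc_lengthN alpha) opprB. Qed.

Lemma angle_dist_ge0 s t : 0 <= angle_dist s t.
Proof. exact: arc_length_ge0. Qed.

Lemma angle_distD t s u : angle_dist s u <= angle_dist s t + angle_dist t u.
Proof.
rewrite -[leLHS]/(arc_length alpha _) -(subrKA (repr t)) addrC.
exact: arc_lengthD.
Qed.

Lemma le_angle_dist_dist t s u :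
  `|angle_dist t s - angle_dist t u| <= angle_dist s u.
Proof.
rewrite ler_distl lerBlDr angle_distD/=.
by rewrite (angle_distC s) angle_distD.
Qed.

Lemma clipped_angle_dist_lip t s u :
  `|Num.min (angle_dist t s) pi - Num.min (angle_dist t u) pi| <= angle_dist s u.
Proof. exact: le_trans (min_lip _ _ _) (le_angle_dist_dist t s u). Qed.

Lemma angle_sub_cos s t :
  angle_dist s t <= pi -> cos (angle_sub t s) = cos (angle_dist s t).
Proof.
move=> stpi; rewrite /angle_sub; case: xgetP => [y _ [/andP[y1 y2] [n yE]]|].
  rewrite -[angle_dist s t]/(arc_length alpha _).
  rewrite -(arc_length_shift alpha _ n) -yE arc_length_small ?cos_norm//.
  by rewrite ler_norml; move: alpha_gt2pi; lra.
(* The default value of [xget] is excluded: the shortest representative lies in [-pi, pi]. *)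
have [n [stE _]] := arc_length_lift alpha_gt0 (repr t - repr s).
move=> /(_ (n%:~R * alpha + (repr t - repr s))) []; split; last by exists n.
by rewrite -ler_norml -stE.
Qed.

End Circle.

Local Notation radius := (@Defs.radius _ _).

(** * Metric and folding map of the kale *)

Section Kale.
Context {R : realType} (alpha : R).
Hypothesis alpha_gt2pi : 2 * pi < alpha.
Implicit Types (s t : circle alpha) (p q : kale alpha).

Lemma radius_ge0 p : 0 <= radius p.
Proof. by case: p => //= r r0 _; exact: ltW. Qed.

Lemma folding1_origin t : (folding t origin).1 = 0.
Proof. by []. Qed.

Lemma folding1_pt t s r (r0 : 0 < r) :
  (folding t (kale_pt r0 s)).1 = r * clipped_cos (angle_dist t s).
Proof.
rewrite /=; case: ifPn => [d|/negbTE]; first 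
  by rewrite angle_sub_cos// clipped_cosE.
by move/negbT; rewrite -ltNge => /ltW d; rewrite clipped_cos_pi//= cospi.
Qed.

Lemma radius_polar r t : 0 <= r -> radius (polar r t) = r.
Proof.
move=> r0; suff h b (e : reflect (0 < r) b) :
    radius (if e is ReflectT r_gt0 then kale_pt r_gt0 t else origin) = r.
  exact: h.
by case: e => //= /negP; rewrite -leNgt => r1; apply/eqP; rewrite eq_le r0.
Qed.

(** The planar points with polar coordinates [(r1, A)] and [(r2, B)] are no farther apart than
    points at angle [theta], and projecting to the first axis shortens distances. *)
Lemma law_of_cosines_lip (r1 r2 A B theta : R) :
    0 <= r1 -> 0 <= r2 -> `|A - B| <= theta -> theta <= pi ->
  `|r1 * cos A - r2 * cos B| <=
    Num.sqrt (r1 ^+ 2 + r2 ^+ 2 - 2 * r1 * r2 * cos theta).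
Proof.
move=> r10 r20 AB thetapi; rewrite -sqrtr_sqr ler_wsqrtr//.
have : cos theta <= cos (A - B).
  by rewrite -(cos_norm (A - B)) le_cos_0pi.
rewrite cosB => h.
have : 0 <= r1 * r2 * (cos A * cos B + sin A * sin B - cos theta).
  by rewrite mulr_ge0 ?subr_ge0 ?mulr_ge0.
have := sqr_ge0 (r1 * sin A - r2 * sin B).
have := cos2Dsin2 A; have := cos2Dsin2 B.
move: (cos A) (cos B) (sin A) (sin B) (cos theta) => cA cB sA sB ct; nra.
Qed.

Lemma kale_dist_origin p : kale_dist origin p = radius p.
Proof. by rewrite /kale_dist /= add0r. Qed.

Lemma radius_lip : lipschitz1 (@Defs.radius R alpha).
Proof.
move=> [|r1 r10 s1] [|r2 r20 s2] /=;
  rewrite ?subrr ?subr0 ?sub0r ?normrN ?normr0 ?addr0 ?add0r//;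
  try by rewrite gtr0_norm.
case: ifPn => [_|].
  by rewrite ler_norml; apply/andP; split; lra.
rewrite -ltNge => /ltW d.
(* With both angles 0 the projections are the radii themselves. *)
have := @law_of_cosines_lip _ _ 0 0 _ (ltW r10) (ltW r20) _ d.
by rewrite cos0 !mulr1 subrr normr0 angle_dist_ge0; exact.
Qed.

(** Clipping the angles to [t] at [pi] does not increase their difference, so [law_of_cosines_lip]
    applies to points at angle below [pi]; otherwise the distance [r1 + r2] dominates trivially. *)
Lemma folding1_lip t : lipschitz1 (fun p => (folding t p).1).
Proof.
move=> [|r1 r10 s1] [|r2 r20 s2]; rewrite ?folding1_origin ?folding1_pt.
- by rewrite subrr normr0 /= addr0.
- rewrite sub0r normrN normrM gtr0_norm// [leRHS]add0r.
  by rewrite ler_piMr ?clipped_cos_norm// ltW.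
- rewrite subr0 normrM gtr0_norm// [leRHS]addr0.
  by rewrite ler_piMr ?clipped_cos_norm// ltW.
rewrite /kale_dist; case: ifPn => [_|].
  apply: (le_trans (ler_normB _ _)); rewrite !normrM (gtr0_norm r10) (gtr0_norm r20).
  by apply: lerD; rewrite ler_piMr ?clipped_cos_norm// ltW.
rewrite -ltNge => /ltW d.
apply: law_of_cosines_lip; rewrite ?(ltW r10) ?(ltW r20)//.
exact: clipped_angle_dist_lip.
Qed.

Lemma folding1_lip_angle s t p :
  `|(folding s p).1 - (folding t p).1| <= angle_dist s t * radius p.
Proof.
case: p => [|r r0 u]; first by rewrite !folding1_origin subrr normr0 mulr0.
rewrite !folding1_pt -mulrBr normrM gtr0_norm//= mulrC ler_pM2r//.
apply: (le_trans (clipped_cos_lip _ _)).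
by rewrite !(angle_distC _ u) le_angle_dist_dist.
Qed.

Lemma lipschitz1N (f : kale alpha -> R) : lipschitz1 f -> lipschitz1 (\- f).
Proof. by move=> fl p q; rewrite /= -opprD normrN. Qed.

Lemma lipschitz1_continuous (f : kale alpha -> R) :
  lipschitz1 f -> continuous f.
Proof.
move=> fl; apply/continuousP => A oA.
change (metric_open (@kale_edist R alpha) (f @^-1` A)) => x fx.
move/open_nbhs_nbhs: (conj oA fx : open_nbhs _ _) => /nbhs_ballP[e e0 eA].
exists e => // y /=; rewrite /kale_edist lte_fin => xy.
by apply: eA; rewrite /ball/=; exact: le_lt_trans (fl _ _) xy.
Qed.

Lemma lipschitz1_measurable (f : kale alpha -> R) :
  lipschitz1 f -> measurable_fun setT f.
Proof.
move=> /lipschitz1_continuous/continuousP fc.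
apply: (measurability _ (RGenOpens.measurableE R)).
move=> _ [_ [a [b ->] <-]]; rewrite setTI; apply: sub_sigma_algebra.
exact/fc/interval_open.
Qed.

End Kale.

(** * Integration against a scaled measure *)

Section IntegralMscale.
Local Open Scope ereal_scope.
Context d (T : measurableType d) (R : realType).
Variables (m : {measure set T -> \bar R}) (k : {nonneg R}) (f : T -> \bar R).

Lemma integral_mscale : m.-integrable setT f ->
  \int[mscale k m]_x f x = k%:num%:E * \int[m]_x f x.
Proof.
move=> fi; have mf := measurable_int _ fi.
rewrite [LHS]integralE !ge0_integral_mscale//; last 2 first.
  exact: measurable_funeneg.
  exact: measurable_funepos.
rewrite [in RHS]integralE [RHS]muleBr//.
by rewrite fin_num_adde_defl// fin_numN integrable_neg_fin_num.
Qed.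

Lemma integrable_mscale : m.-integrable setT f ->
  (mscale k m).-integrable setT f.
Proof.
move=> /integrableP[mf fi]; apply/integrableP; split => //.
rewrite ge0_integral_mscale//; last exact: measurableT_comp.
by rewrite lte_mul_pinfty.
Qed.

End IntegralMscale.

(** * Normalization and sums of integrable measures *)

Section Integration.
Context {R : realType} {alpha : R}.
Local Open Scope quotient_scope.
Implicit Types (mu nu : M1 alpha) (x y : M1_class alpha) (f : kale alpha -> R).

Lemma lipschitz1_le_radius f p : lipschitz1 f -> `|f p - f origin| <= radius p.
Proof. by move=> fl; rewrite distrC -kale_dist_origin. Qed.

(** Domination by [|f origin| + radius]: the constant is integrable because [mu] is finite, the
    radius because of the first moment. *)
Lemma lipschitz1_integrable mu f :
  lipschitz1 f -> mu.-integrable setT (EFin \o f).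
Proof.
move=> fl; have mf := lipschitz1_measurable fl.
have ri : mu.-integrable setT (EFin \o radius).
  apply/integrableP; split.
    by apply/measurable_EFinP; apply: lipschitz1_measurable; exact: radius_lip.
  apply: le_lt_trans (M1_integrable mu); rewrite le_eqVlt; apply/orP; left.
  apply/eqP/eq_integral => p _.
  by rewrite kale_dist_origin gee0_abs// lee_fin radius_ge0.
have ci := finite_measure_integrable_cst mu `|f origin| measurableT.
apply: (le_integrable measurableT _ _ (integrableD measurableT ci ri)).
  exact/measurable_EFinP.
move=> p _ /=; rewrite lee_fin [leRHS]ger0_norm ?addr_ge0 ?radius_ge0//.
have := lipschitz1_le_radius p fl.
by have := ler_normD (f p - f origin) (f origin); rewrite subrK; lra.
Qed.

Definition mass mu : R := fine (mu setT).

Lemma mass_gt0 mu : 0 < mass mu.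
Proof.
rewrite fine_gt0// lt0e M1_neq0 measure_ge0/=.
by rewrite -ge0_fin_numE// fin_num_measure.
Qed.

Lemma inv_mass_ge0 mu : 0 <= (mass mu)^-1.
Proof. by rewrite invr_ge0 ltW// mass_gt0. Qed.

Lemma normalize_mscale mu A :
  normalize mu A = mscale (NngNum (inv_mass_ge0 mu)) mu A.
Proof. by rewrite normalize_M1E muleC. Qed.

Lemma integrable_normalize mu f :
  lipschitz1 f -> (normalize mu).-integrable setT (EFin \o f).
Proof.
move=> fl; have mf : measurable_fun setT (EFin \o f).
  by apply/measurable_EFinP; exact: lipschitz1_measurable.
apply/integrableP; split => //.
rewrite (@eq_measure_integral _ _ _ _ (mscale (NngNum (inv_mass_ge0 mu)) mu)); last first.
  by move=> A _ _; exact: normalize_mscale.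
have /integrableP[] // :
  (mscale (NngNum (inv_mass_ge0 mu)) mu).-integrable setT (EFin \o f).
exact/integrable_mscale/lipschitz1_integrable.
Qed.

Lemma Rintegral_normalize mu f : lipschitz1 f ->
  \int[normalize mu]_p f p = (mass mu)^-1 * \int[mu]_p f p.
Proof.
move=> fl; have fi := lipschitz1_integrable mu fl.
rewrite /Rintegral.
rewrite [X in fine X = _](@eq_measure_integral _ _ _ _
  (mscale (NngNum (inv_mass_ge0 mu)) mu)); last first.
  by move=> A _ _; exact: normalize_mscale.
by rewrite integral_mscale// fineM//= integrable_fin_num.
Qed.

Lemma Rintegral_unit_mass mu f : lipschitz1 f ->
  \int[unit_mass (\pi_(M1_class alpha) mu)]_p f p = (mass mu)^-1 * \int[mu]_p f p.
Proof.
move=> fl; rewrite -Rintegral_normalize// /Rintegral; congr fine.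
by apply: eq_measure_integral => A mA _; exact: unit_massE.
Qed.

Lemma Rintegral_repr x f : lipschitz1 f ->
  \int[repr x]_p f p = mass (repr x) * \int[unit_mass x]_p f p.
Proof.
move=> fl; rewrite Rintegral_normalize// mulrA divff ?mul1r//.
by rewrite gt_eqF// mass_gt0.
Qed.

Section Combination.
Variables (mu nu : M1 alpha) (e : {nonneg R}).

Let sum_measure : {measure set (kale alpha) -> \bar R} :=
  measure_add mu (mscale e nu).

Let sum_fin_num : fin_num_fun sum_measure.
Proof.
move=> A mA; have -> : sum_measure A = (mu A + mscale e nu A)%E.
  exact: measure_addE.
by rewrite fin_numD !fin_num_measure.
Qed.

Let sum_finite : {finite_measure set (kale alpha) -> \bar R} :=
  HB.pack (Measure.sort sum_measure) sum_measure
    (@Measure_isFinite.Build _ _ _ _ sum_fin_num).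

Let sum_neq0 : sum_finite setT != 0%E.
Proof.
have -> : sum_finite setT = (mu setT + mscale e nu setT)%E.
  exact: measure_addE.
by rewrite padde_eq0 ?measure_ge0// negb_and M1_neq0.
Qed.

Let sum_integrable : (\int[sum_finite]_p (kale_dist origin p)%:E < +oo)%E.
Proof.
have mr : measurable_fun setT (fun p : kale alpha => (kale_dist origin p)%:E).
  apply/measurable_EFinP; apply: lipschitz1_measurable.
  by move=> p q; rewrite !kale_dist_origin; exact: radius_lip.
have r0 p : (0 <= (kale_dist (origin : kale alpha) p)%:E)%E.
  by rewrite lee_fin kale_dist_origin radius_ge0.
have -> : (\int[sum_finite]_p (kale_dist origin p)%:E =
    \int[mu]_p (kale_dist origin p)%:E +
    \int[mscale e nu]_p (kale_dist origin p)%:E)%E.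
  exact: ge0_integral_measure_add.
apply: lte_add_pinfty; first exact: M1_integrable.
by rewrite ge0_integral_mscale// lte_mul_pinfty ?M1_integrable ?integral_ge0.
Qed.

Definition M1_add : M1 alpha := mkM1 sum_neq0 sum_integrable.

Lemma mass_add : mass M1_add = mass mu + e%:num * mass nu.
Proof.
have addE : M1_add setT = (mu setT + mscale e nu setT)%E by exact: measure_addE.
rewrite /mass addE fineD ?fin_num_measure//.
by rewrite /mscale fineM ?fin_num_measure.
Qed.

Lemma Rintegral_add f : lipschitz1 f ->
  \int[M1_add]_p f p = \int[mu]_p f p + e%:num * \int[nu]_p f p.
Proof.
move=> fl; have mf := lipschitz1_measurable fl.
have fmu := lipschitz1_integrable mu fl.
have fnu := lipschitz1_integrable nu fl.
rewrite [LHS](congr1 fine (integral_measure_add measurableT fmu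
  (integrable_mscale e fnu))).
rewrite fineD ?integrable_fin_num ?integrable_mscale//.
by rewrite integral_mscale// fineM ?integrable_fin_num.
Qed.

End Combination.

End Integration.

(** * Expectations and the Wasserstein distance *)

Section Expectation.
Context {R : realType} {alpha : R}.
Local Open Scope quotient_scope.
Implicit Types (mu nu : M1 alpha) (x y z : M1_class alpha).
Implicit Types f g h : kale alpha -> R.

Definition class_integral x f : R := \int[unit_mass x]_p f p.
Local Notation "''E_' x f" := (class_integral x f)
  (at level 10, x at level 2, f at level 8).

Lemma integrable_unit_mass x f :
  lipschitz1 f -> (unit_mass x).-integrable setT (EFin \o f).
Proof. exact: integrable_normalize. Qed.

(** Carries pointwise estimates over to expectations. The coefficients stay outside because
    integrability comes from [lipschitz1], which a multiple of [f] need not satisfy. *)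
Lemma class_integral_linear_le x f g h (a b c : R) :
    lipschitz1 f -> lipschitz1 g -> lipschitz1 h ->
    (forall p, a * f p + b * g p <= c * h p) ->
  a * 'E_x f + b * 'E_x g <= c * 'E_x h.
Proof.
move=> /(integrable_unit_mass x) fi /(integrable_unit_mass x) gi.
move=> /(integrable_unit_mass x) hi fgh.
rewrite /class_integral -!RintegralZl// -RintegralD//; last 2 first.
  exact: (integrableZl measurableT a fi).
  exact: (integrableZl measurableT b gi).
apply: le_Rintegral => //.
  apply: (integrableD measurableT (integrableZl measurableT a fi)
    (integrableZl measurableT b gi)).
exact: (integrableZl measurableT c hi).
Qed.

Lemma class_integralN x f : lipschitz1 f -> 'E_x (\- f) = - 'E_x f.
Proof.
move=> /(integrable_unit_mass x) fi.
rewrite -mulN1r /class_integral -RintegralZl//.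
by apply: eq_Rintegral => p _; rewrite mulN1r.
Qed.

Lemma lipschitz1_cst (c : R) : lipschitz1 ((fun=> c) : kale alpha -> R).
Proof.
move=> p q; rewrite subrr normr0.
exact: le_trans (normr_ge0 _) (radius_lip p q).
Qed.

Lemma class_integral_cst x c : 'E_x (fun=> c) = c.
Proof.
have P1 : unit_mass x setT = 1%E by exact: probability_setT.
by rewrite /class_integral Rintegral_cst// [X in fine X]P1 mulr1.
Qed.

Lemma class_integral_le_radius x f :
  lipschitz1 f -> `|'E_x f - f origin| <= 'E_x radius.
Proof.
move=> fl; rewrite ler_norml.
have := @class_integral_linear_le x f radius (fun=> 1) 1 (-1) (f origin) fl
  (@radius_lip _ _) (lipschitz1_cst 1).
have := @class_integral_linear_le x f radius (fun=> 1) (-1) (-1) (- f origin) fl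
  (@radius_lip _ _) (lipschitz1_cst 1).
rewrite class_integral_cst => h1 h2; apply/andP; split.
  have : -1 * 'E_x f + -1 * 'E_x radius <= - f origin * 1.
    by apply: h1 => p; have := lipschitz1_le_radius p fl; rewrite ler_norml; lra.
  lra.
have : 1 * 'E_x f + -1 * 'E_x radius <= f origin * 1.
  by apply: h2 => p; have := lipschitz1_le_radius p fl; rewrite ler_norml; lra.
lra.
Qed.

Lemma class_dist_ge x y f :
  lipschitz1 f -> (('E_x f - 'E_y f)%:E <= class_dist x y)%E.
Proof.
move=> fl; apply: ereal_sup_ubound; exists f => //.
rewrite EFinB /class_integral /Rintegral !fineK//;
  exact: integrable_fin_num (integrable_unit_mass _ fl).
Qed.

Lemma class_dist_le x y (c : R) :
  (forall f, lipschitz1 f -> 'E_x f - 'E_y f <= c) ->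
  (class_dist x y <= c%:E)%E.
Proof.
move=> xyc; apply: ge_ereal_sup => _ [f fl <-].
have fin z : (\int[unit_mass z]_p (f p)%:E)%E \is a fin_num.
  exact: integrable_fin_num (integrable_unit_mass z fl).
by rewrite -(fineK (fin x)) -(fineK (fin y)) -EFinB lee_fin; exact: xyc.
Qed.

Lemma class_integral_pi_add mu nu (e : {nonneg R}) f : lipschitz1 f ->
  'E_(\pi_(M1_class alpha) (M1_add mu nu e)) f =
  (\int[mu]_p f p + e%:num * \int[nu]_p f p) / (mass mu + e%:num * mass nu).
Proof.
by move=> fl; rewrite /class_integral Rintegral_unit_mass// Rintegral_add// mass_add mulrC.
Qed.

(** The representatives have arbitrary masses, which therefore appear as weights in the
    expectations. *)
Definition mix x y (e : {nonneg R}) : M1_class alpha :=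
  \pi_(M1_class alpha) (M1_add (repr x) (repr y) e).

Lemma class_integral_mix x y (e : {nonneg R}) f : lipschitz1 f ->
  'E_(mix x y e) f =
  (mass (repr x) * 'E_x f + e%:num * mass (repr y) * 'E_y f) /
    (mass (repr x) + e%:num * mass (repr y)).
Proof. by move=> fl; rewrite class_integral_pi_add// !Rintegral_repr// mulrA. Qed.

(** Mixing changes the expectation of [f] by a small multiple of ['E_x f - 'E_y f]. Here [f origin]
    cancels, so the two first moments bound this difference for all [f] at once. *)
Lemma mix_near x y (W : set (M1_class alpha)) : open W -> W x ->
  exists2 e : {nonneg R}, 0 < e%:num & W (mix x y e).
Proof.
move=> oW Wx; have {}oW : metric_open (@class_dist R alpha) W by [].
have [d d0 dW] := oW _ Wx.
set k := mass (repr x); set n := mass (repr y).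
have k0 : 0 < k by exact: mass_gt0.
have n0 : 0 < n by exact: mass_gt0.
pose C := 'E_x radius + 'E_y radius + 1.
have C0 : 0 < C.
  (* Applied to the zero function, the bound says that first moments are nonnegative. *)
  have := class_integral_le_radius x (lipschitz1_cst 0).
  have := class_integral_le_radius y (lipschitz1_cst 0).
  have := normr_ge0 ('E_x (fun=> 0) - 0); have := normr_ge0 ('E_y (fun=> 0) - 0).
  rewrite /C; lra.
(* Solves [e0 * n * C / k = d]; half of it gives the strict inequality. *)
pose e0 := d * k / (n * C); have e0_gt0 : 0 < e0 by rewrite divr_gt0 ?mulr_gt0.
have e20 : 0 <= e0 / 2 by rewrite divr_ge0// ltW.
exists (NngNum e20); first by rewrite divr_gt0.
set e := NngNum e20; have eC : e%:num < e0 by rewrite ltr_pdivrMr// ltr_pMr// ltr1n.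
have ege0 : 0 <= e%:num by [].
apply: dW => /=.
have kn0 : 0 < k + e%:num * n by rewrite ltr_wpDr// mulr_ge0// ltW.
apply: (@le_lt_trans _ _ (e%:num * n * C / k)%:E); last first.
  rewrite lte_fin ltr_pdivrMr//; move: eC; rewrite ltr_pdivlMr ?mulr_gt0//.
  by rewrite mulrA.
apply: class_dist_le => f fl; rewrite class_integral_mix// -/k -/n.
have -> : 'E_x f - (k * 'E_x f + e%:num * n * 'E_y f) / (k + e%:num * n) =
    e%:num * n * ('E_x f - 'E_y f) / (k + e%:num * n).
  by field; rewrite gt_eqF.
have fC : 'E_x f - 'E_y f <= C.
  have := class_integral_le_radius x fl; have := class_integral_le_radius y fl.
  by rewrite !ler_norml /C; lra.
apply: (@le_trans _ _ (e%:num * n * C / (k + e%:num * n))).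
  by rewrite ler_pM2r ?invr_gt0// ler_wpM2l// mulr_ge0// ltW.
apply: ler_wpM2l; first by rewrite mulr_ge0 ?(ltW C0)// mulr_ge0 ?(ltW n0).
by rewrite lef_pV2 ?posrE// lerDl mulr_ge0// ltW.
Qed.

Let dirac_neq0 (p : kale alpha) : (dirac p : set _ -> \bar R) setT != 0%E.
Proof. by rewrite diracT onee_neq0. Qed.

Let dirac_integrable (p : kale alpha) :
  (\int[@dirac _ _ p R]_q (kale_dist origin q)%:E < +oo)%E.
Proof.
rewrite integral_dirac ?diracT ?mul1e ?ltry//.
apply/measurable_EFinP; apply: lipschitz1_measurable => q r.
by rewrite !kale_dist_origin; exact: radius_lip.
Qed.

Definition point_mass p : M1 alpha :=
  @mkM1 R alpha (@dirac _ _ p R) (dirac_neq0 p) (dirac_integrable p).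

Lemma Rintegral_point_mass p f : lipschitz1 f -> \int[point_mass p]_q f q = f p.
Proof.
move=> fl; rewrite /Rintegral /= integral_dirac ?diracT ?mul1e//.
by apply/measurable_EFinP; exact: lipschitz1_measurable.
Qed.

Lemma mass_point_mass p : mass (point_mass p) = 1.
Proof.
have P1 : point_mass p setT = 1%E by exact: diracT.
by rewrite /mass P1.
Qed.

Lemma class_integral_point_mass p f :
  lipschitz1 f -> 'E_(\pi_(M1_class alpha) (point_mass p)) f = f p.
Proof.
move=> fl; rewrite /class_integral Rintegral_unit_mass// Rintegral_point_mass//.
by rewrite mass_point_mass invr1 mul1r.
Qed.

End Expectation.

(* Sealed, since unification otherwise unfolds the integral when it compares
   [pull x s] with [pull x t]. *)
HB.lock Definition pull {R : realType} {alpha : R}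
  (x : M1_class alpha) (t : circle alpha) : R := (folded_mean (unit_mass x) t).1.

(** * Pull, peak and the three kinds of stickiness *)

Section Pull.
Context {R : realType} {alpha : R}.
Hypothesis alpha_gt2pi : 2 * pi < alpha.
Local Open Scope quotient_scope.
Implicit Types (x y z : M1_class alpha) (s t : circle alpha).

Let alpha_gt0 : 0 < alpha.
Proof. by move: alpha_gt2pi (pi_gt0 R); lra. Qed.

Let fl t : lipschitz1 (fun p => (folding t p).1) := folding1_lip alpha_gt2pi t.

Lemma pullE x t : pull x t = class_integral x (fun p => (folding t p).1).
Proof. by rewrite pull.unlock. Qed.

Lemma sticky_set_pull x : sticky_set (unit_mass x) = [set t | 0 <= pull x t].
Proof. by rewrite pull.unlock. Qed.

Lemma folded_mean_pull x t : (folded_mean (unit_mass x) t).1 = pull x t.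
Proof. by rewrite pull.unlock. Qed.

Lemma pull_lip x s t :
  `|pull x s - pull x t| <= angle_dist s t * class_integral x radius.
Proof.
have h u v (d : R) :
    (forall p, `|(folding u p).1 - (folding v p).1| <= d * radius p) ->
    1 * pull x u + -1 * pull x v <= d * class_integral x radius.
  move=> uv; rewrite !pullE.
  apply: class_integral_linear_le (fl u) (fl v) (@radius_lip _ _) _ => p.
  by have := uv p; rewrite ler_norml; lra.
have := h s t _ (folding1_lip_angle alpha_gt2pi s t).
have := h t s _ (folding1_lip_angle alpha_gt2pi t s).
rewrite ler_norml (angle_distC t s).
by move: (pull x s) (pull x t) (class_integral x _) => ? ? ?; lra.
Qed.

Lemma pull_pi_continuous x : continuous (fun a : R => pull x (\pi_(circle alpha) a)).
Proof.
move=> a; apply/cvgrPdist_le => /= e e0.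
have r0 : 0 <= class_integral x radius by apply: Rintegral_ge0 => p _; exact: radius_ge0.
near=> b; apply: (le_trans (pull_lip _ _ _)).
rewrite angle_dist_pi//.
(* The added 1 keeps the divisor positive even if the first moment vanishes. *)
apply: (@le_trans _ _ (`|b - a| * (class_integral x radius + 1))).
  by apply: ler_pM; rewrite ?arc_length_ge0 ?arc_length_le_norm// lerDl.
rewrite -ler_pdivlMr; last by lra.
rewrite distrC; near: b; apply: cvgr_dist_le; first exact: cvg_id.
by rewrite divr_gt0//; lra.
Unshelve. all: by end_near. Qed.

(** The extreme value theorem on one full turn [[0, alpha]], which meets every class of angles. *)
Lemma pull_max x : exists t, forall s, pull x s <= pull x t.
Proof.
have [c _ cmax] := @EVT_max R _ 0 alpha (ltW alpha_gt0)
  (continuous_subspaceT (@pull_pi_continuous x)).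
exists (\pi c) => s.
pose y := repr s; pose n := Num.floor (y / alpha).
have /andP[n1 n2] := floor_itv (y / alpha).
have -> : s = \pi_(circle alpha) (y - n%:~R * alpha).
  rewrite -[LHS]reprK -/y; apply/eqmodP/asboolP.
  by exists n; rewrite opprB addrC subrK.
apply: cmax; rewrite in_itv/= subr_ge0 -ler_pdivlMr// n1/=.
by move: n2; rewrite intrD ltr_pdivrMr//; lra.
Qed.

Lemma pull_concave x (y a b : R) : 0 < a -> 0 < b -> a + b < pi ->
  sin a * pull x (\pi_(circle alpha) (y - b)) +
    sin b * pull x (\pi_(circle alpha) (y + a)) <=
  sin (a + b) * pull x (\pi_(circle alpha) y).
Proof.
move=> a0 b0 abpi; rewrite !pullE.
apply: class_integral_linear_le (fl _) (fl _) (fl _) _ => p.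
case: p => [|r r0 s]; first by rewrite !folding1_origin !mulr0 addr0.
rewrite !folding1_pt// -(reprK s) !angle_dist_pi//.
rewrite ![_ * (r * _)]mulrCA -mulrDr ler_pM2l//.
(* Turning the direction forward decreases its offset [repr s - y] to the mass, so [a] and [b] trade
   places. *)
have := @clipped_cos_arc_concave _ alpha alpha_gt0 alpha_gt2pi (repr s - y) b a.
rewrite (addrC b a) !opprD !addrA !opprK => h.
by rewrite [leLHS]addrC; exact: h.
Qed.

(** By the triangle inequality the distances from any [u] to [s] and [t] sum to at least [pi], so
    the integrands already add up to at most 0 pointwise. *)
Lemma pull_antipodal x s t :
  pi <= angle_dist s t -> pull x s + pull x t <= 0.
Proof.
(* The third function is a placeholder with coefficient 0. *)
move=> st; have := @class_integral_linear_le _ _ x _ _ _ 1 1 0 (fl s) (fl t) (fl s).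
rewrite -!pullE !mul1r mul0r; apply; case=> [|r r0 u].
  by rewrite !folding1_origin mul0r mulr0 addr0.
rewrite !mul1r mul0r !folding1_pt// -mulrDr mulr_ge0_le0 ?(ltW r0)//.
apply: clipped_cosD_le0; rewrite ?angle_dist_ge0//.
by rewrite (angle_distC t); exact: le_trans st (angle_distD _ _ _ _).
Qed.

(* The same choice as in [mean]. *)
Definition peak x : R := pull x [get t | forall s, pull x s <= pull x t].

Lemma peak_ge x s : pull x s <= peak x.
Proof.
rewrite /peak; case: xgetP => [t _ /(_ s)//|h].
by have [t tmax] := pull_max x; case: (h t).
Qed.

Lemma pull_peak x : exists t, pull x t = peak x.
Proof. by exists [get t | forall s, pull x s <= pull x t]. Qed.

Lemma fully_stickyP x : fully_sticky (unit_mass x) <-> peak x < 0.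
Proof.
rewrite /fully_sticky sticky_set_pull; split=> [x0|x0]; last first.
  rewrite -subset0 => t /= t0; have := le_lt_trans (peak_ge x t) x0.
  by rewrite ltNge t0.
have [t <-] := pull_peak x; rewrite ltNge; apply/negP => t0.
by have : set0 t by rewrite -x0.
Qed.

Lemma partly_stickyP x : partly_sticky (unit_mass x) <-> peak x = 0.
Proof.
have [t tE] := pull_peak x; rewrite /partly_sticky sticky_set_pull.
split=> [[[s /= s0] x0]|x0].
  rewrite -tE -folded_mean_pull; apply: x0 => /=.
  by rewrite tE; exact: le_trans s0 (peak_ge x s).
split; first by exists t; rewrite /= tE x0.
move=> s s0; rewrite folded_mean_pull.
by apply/eqP; rewrite eq_le s0 andbT -x0; exact: peak_ge.
Qed.

(** In the converse, an interior direction [t] other than the maximizer [s] lies between [s] and a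
    nearby direction on the far side. The pull is positive at [s] and nonnegative at the other end,
    hence positive at [t] by concavity. *)
Lemma nonstickyP x : nonsticky (unit_mass x) <-> 0 < peak x.
Proof.
rewrite /nonsticky sticky_set_pull; split=> [[[s sK] x0]|x0].
  by apply: lt_le_trans (peak_ge x s); rewrite -folded_mean_pull; exact: x0.
split.
  have [t tE] := pull_peak x; exists t.
  have oU : open [set s | 0 < pull x s].
    change (open (\pi_(circle alpha) @^-1` [set s | 0 < pull x s])).
    have /continuousP cp := @pull_pi_continuous x.
    exact: cp (@open_gt R 0).
  have Ut : [set s | 0 < pull x s] t by rewrite /= tE.
  by apply: filterS (open_nbhs_nbhs (conj oU Ut)) => s /ltW.
move=> t tK; rewrite folded_mean_pull.
have [s sE] := pull_peak x; rewrite -sE in x0.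
have t0 : 0 <= pull x t by exact: interior_subset tK.
(* The maximizer cannot be [pi] or more away: its positive pull and the nonnegative one at [t] would
   have a positive sum. *)
have [st|st] := leP pi (angle_dist t s).
  have := pull_antipodal x st; rewrite addrC => st0.
  by have := lt_le_trans (ltr_wpDr t0 x0) st0; rewrite ltxx.
have [n [nE _]] := arc_length_lift alpha_gt0 (repr s - repr t).
rewrite -[angle_dist t s]/(arc_length alpha _) nE in st.
(* [v] is the signed angle from [t] to [s], with [|v| < pi]. *)
pose w : R := repr t; set v := _ + _ in st.
have {nE}sv : s = \pi_(circle alpha) (w + v).
  rewrite -[LHS]reprK; apply/eqmodP/asboolP; exists (- n).
  by rewrite /v /w mulrNz mulNr; ring.
have [v0|v0] := eqVneq v 0; first by move: x0; rewrite sv v0 addr0 /w reprK.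
have /nbhs_ballP[e /= e0 eK] : nbhs w [set a | 0 <= pull x (\pi_(circle alpha) a)].
  have := @pi_continuous _ {eq_quot angle_equiv alpha} w.
  move/(_ [set s | 0 <= pull x s]); apply.
  change (nbhs (\pi_(circle alpha) (repr t)) [set s | 0 <= pull x s]).
  by rewrite reprK.
have K0 a : `|w - a| < e -> 0 <= pull x (\pi_(circle alpha) a).
  by move=> wa; apply: eK; rewrite /ball/=.
(* Small enough that [w - b] and [w + b] stay in the sticky set and that the angle [b + |v|] stays
   below [pi], as concavity demands. *)
pose b := Num.min (e / 2) ((pi - `|v|) / 2).
have b0 : 0 < b by rewrite lt_min !divr_gt0// subr_gt0.
have be : b < e by rewrite gt_min ltr_pdivrMr// ltr_pMr// ltr1n.
have bv : b + `|v| < pi.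
  rewrite -ltrBrDr gt_min; apply/orP; right.
  by rewrite ltr_pdivrMr// ltr_pMr ?ltr1n// subr_gt0.
have sb : 0 < sin b by apply: sin_gt0_pi; rewrite b0 (le_lt_trans _ bv)// lerDl.
have svb : 0 < sin (b + `|v|) by apply: sin_gt0_pi; rewrite bv andbT ltr_wpDr.
have sv0 : 0 < sin `|v| by apply: sin_gt0_pi; rewrite normr_gt0 v0 st.
rewrite -(pmulr_rgt0 _ svb) -[t]reprK -/w.
have [vp|vn] := ltP 0 v.
  move: bv svb sv0; rewrite (gtr0_norm vp) => bv svb sv0.
  rewrite addrC; apply: lt_le_trans (pull_concave x w vp b0 _); last by rewrite addrC.
  rewrite -sv; apply: ltr_wpDl; last exact: mulr_gt0.
  apply: mulr_ge0; [exact: ltW|apply: K0].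
  by rewrite opprB addrC subrK gtr0_norm.
have {vn}vn : v < 0 by rewrite lt_neqAle v0.
move: bv svb sv0; rewrite (ltr0_norm vn) => bv svb sv0.
have vn' : 0 < - v by rewrite oppr_gt0.
apply: lt_le_trans (pull_concave x w b0 vn' bv).
rewrite opprK -sv; apply: ltr_pwDl; first exact: mulr_gt0.
apply: mulr_ge0; [exact: ltW|apply: K0].
by rewrite opprD addNKr normrN gtr0_norm.
Qed.

Lemma class_mean_origin x : peak x <= 0 -> class_mean x = origin.
Proof.
move=> x0; rewrite /class_mean /mean ifF//; apply/asboolPn => /nonstickyP.
by rewrite ltNge x0.
Qed.

Lemma radius_class_mean x : 0 < peak x -> radius (class_mean x) = peak x.
Proof.
move=> x0; rewrite /class_mean /mean ifT; last exact/asboolP/nonstickyP.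
by move: x0; rewrite /peak pull.unlock => /ltW/radius_polar.
Qed.

(** All pulls are expectations of 1-Lipschitz functions, hence move by less than [e]; evaluating at
    both maximizers transfers this to the maxima. *)
Lemma peak_dist x y (e : R) : (class_dist x y < e%:E)%E -> `|peak x - peak y| < e.
Proof.
move=> xye; have h t : `|pull x t - pull y t| < e.
  rewrite ltr_norml; apply/andP; split.
    (* The supremum bounds signed differences only; the negated function supplies the other side. *)
    have := le_lt_trans (class_dist_ge x y (lipschitz1N (fl t))) xye.
    rewrite !class_integralN// lte_fin -!pullE.
    by move: (pull x t) (pull y t) => ? ?; lra.
  have := le_lt_trans (class_dist_ge x y (fl t)) xye.
  by rewrite lte_fin -!pullE.
have [s sE] := pull_peak x; have [t tE] := pull_peak y.
move: (h s) (h t) (peak_ge x t) (peak_ge y s); rewrite -sE -tE !ltr_norml.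
move: (pull x s) (pull x t) (pull y s) (pull y t) => a b c d.
by clear; lra.
Qed.

Lemma pull_mix x y (e : {nonneg R}) t : pull (mix x y e) t =
  (mass (repr x) * pull x t + e%:num * mass (repr y) * pull y t) /
    (mass (repr x) + e%:num * mass (repr y)).
Proof. by rewrite !pullE class_integral_mix. Qed.

End Pull.

(** * Small perturbations of a class *)

Section Perturbation.
Context {R : realType} {alpha : R}.
Hypothesis alpha_gt2pi : 2 * pi < alpha.
Local Open Scope quotient_scope.
Implicit Types (x y : M1_class alpha) (t : circle alpha) (e : {nonneg R}).

Let alpha_gt0 : 0 < alpha.
Proof. by move: alpha_gt2pi (pi_gt0 R); lra. Qed.

Let fl t : lipschitz1 (fun p => (folding t p).1) := folding1_lip alpha_gt2pi t.

Lemma peak_lt0_open : open [set x : M1_class alpha | peak x < 0].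
Proof.
change (metric_open (@class_dist R alpha) [set x | peak x < 0]) => x /= x0.
exists (- peak x); first by rewrite oppr_gt0.
move=> y /= /(peak_dist alpha_gt2pi); rewrite ltr_norml; move: x0.
by move: (peak x) (peak y) => u v; lra.
Qed.

Lemma peak_gt0_open : open [set x : M1_class alpha | 0 < peak x].
Proof.
change (metric_open (@class_dist R alpha) [set x | 0 < peak x]) => x /= x0.
exists (peak x) => // y /= /(peak_dist alpha_gt2pi); rewrite ltr_norml; move: x0.
by move: (peak x) (peak y) => u v; lra.
Qed.

Lemma pull_mix_lt0 x y e t :
  mass (repr x) * pull x t + e%:num * mass (repr y) * pull y t < 0 ->
  pull (mix x y e) t < 0.
Proof.
move=> xy; rewrite pull_mix// pmulr_llt0// invr_gt0.
by rewrite ltr_wpDr ?mass_gt0// mulr_ge0// ltW// mass_gt0.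
Qed.

Lemma peak_mix_lt0 x y e :
  peak x <= 0 -> peak y < 0 -> 0 < e%:num -> peak (mix x y e) < 0.
Proof.
move=> x0 y0 e0; have [t <-] := pull_peak (mix x y e).
apply: pull_mix_lt0; apply: ltr_wnDl.
  by rewrite pmulr_rle0 ?mass_gt0// (le_trans (peak_ge alpha_gt2pi x t)).
by rewrite pmulr_rlt0 ?mulr_gt0 ?mass_gt0// (le_lt_trans (peak_ge alpha_gt2pi y t)).
Qed.

Definition origin_class : M1_class alpha :=
  \pi_(M1_class alpha) (point_mass origin).

Definition ray_class t : M1_class alpha :=
  \pi_(M1_class alpha) (point_mass (kale_pt ltr01 t)).

Lemma peak_mix_ray x t e : 0 <= pull x t -> 0 < e%:num ->
  0 < peak (mix x (ray_class t) e).
Proof.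
move=> x0 e0; set y := ray_class t.
apply: lt_le_trans (peak_ge alpha_gt2pi _ t).
have y1 : pull y t = 1.
  rewrite pullE class_integral_point_mass// folding1_pt// mul1r.
  rewrite /angle_dist -/(arc_length _ _) subrr.
  rewrite arc_length_small ?normr0 ?divr_ge0 ?(ltW alpha_gt0)//.
  by rewrite clipped_cosE ?cos0 ?pi_ge0.
rewrite pull_mix// y1 mulr1.
have m0 : 0 < e%:num * mass (repr y) by rewrite mulr_gt0// mass_gt0.
have k0 := mass_gt0 (repr x).
apply: divr_gt0; last exact: addr_gt0.
by apply: ltr_wpDl => //; apply: mulr_ge0 => //; exact: ltW.
Qed.

Lemma peak_mix_origin x e : 0 < peak x -> 0 < e%:num ->
  peak (mix x origin_class e) < peak x.
Proof.
move=> x0 e0; set y := origin_class; have [t <-] := pull_peak (mix x y e).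
have y0 : pull y t = 0 by rewrite pullE class_integral_point_mass.
have m0 : 0 < e%:num * mass (repr y) by rewrite mulr_gt0// mass_gt0.
have k0 := mass_gt0 (repr x).
rewrite pull_mix// y0 mulr0 addr0 ltr_pdivrMr ?addr_gt0//.
apply: (@le_lt_trans _ _ (mass (repr x) * peak x)).
  by rewrite ler_pM2l// peak_ge.
by rewrite mulrC ltr_pM2l// ltrDl.
Qed.

(** The radius of the mean recovers a positive peak, while a nonpositive peak of [y] would put the
    common mean at the origin. *)
Lemma peak_class_mean x y : 0 < peak x -> class_mean y = class_mean x ->
  peak y = peak x.
Proof.
move=> x0 yx; have := radius_class_mean alpha_gt2pi x0; rewrite -yx => rE.
have [y0|y0] := ltP 0 (peak y).
  by rewrite -(radius_class_mean alpha_gt2pi y0).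
by move: x0; rewrite -rE (class_mean_origin alpha_gt2pi y0) ltxx.
Qed.

Lemma class_mean_neq x y : peak x <= 0 < peak y -> class_mean y <> class_mean x.
Proof.
by move=> /andP[x0 y0] /esym/(peak_class_mean y0) xy; move: x0; rewrite xy leNgt y0.
Qed.

(* Four equally spaced unit masses: the two masses of each antipodal pair
   cancel, up to a strict gain away from their own directions. *)
Lemma exists_peak_lt0 : exists x : M1_class alpha, peak x < 0.
Proof.
pose P (a : R) := kale_pt ltr01 (\pi_(circle alpha) a) : kale alpha.
pose add mu nu : M1 alpha := M1_add mu nu (NngNum (@ler01 R)).
pose mu := add (add (add (point_mass (P 0)) (point_mass (P (alpha / 2))))
  (point_mass (P (alpha / 4)))) (point_mass (P (- (alpha / 4)))).
exists (\pi_(M1_class alpha) mu).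
have [t <-] := pull_peak (\pi_(M1_class alpha) mu).
rewrite pullE /class_integral Rintegral_unit_mass// pmulr_rlt0 ?invr_gt0 ?mass_gt0//.
rewrite !Rintegral_add// !Rintegral_point_mass//=.
rewrite !folding1_pt// !mul1r.
pose d a := angle_dist t (\pi_(circle alpha) a).
rewrite -!/(d _).
have d0 a : 0 <= d a by exact: angle_dist_ge0.
have dD a b : arc_length alpha (b - a) <= d a + d b.
  rewrite -angle_dist_pi// /d (angle_distC t); exact: angle_distD.
have small a : `|a| <= alpha / 2 -> arc_length alpha a = `|a|.
  exact: arc_length_small.
have a2 : 0 < alpha / 2 by rewrite divr_gt0.
have a4 : 0 < alpha / 4 by rewrite divr_gt0.
(* [h1] and [h2] concern the two antipodal pairs, at mutual distance [alpha / 2 > pi]; [h3] to [h6]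
   say that [t] cannot hit a member of each pair. *)
have h1 : alpha / 2 <= d 0 + d (alpha / 2).
  by apply: le_trans (dD _ _); rewrite subr0 small gtr0_norm.
have h2 : alpha / 2 <= d (alpha / 4) + d (- (alpha / 4)).
  rewrite addrC; apply: le_trans (dD _ _); rewrite opprK.
  have -> : alpha / 4 + alpha / 4 = alpha / 2 by lra.
  by rewrite small gtr0_norm.
have h3 : alpha / 4 <= d 0 + d (alpha / 4).
  by apply: le_trans (dD _ _); rewrite subr0 small gtr0_norm//; lra.
have h4 : alpha / 4 <= d 0 + d (- (alpha / 4)).
  by apply: le_trans (dD _ _); rewrite subr0 small normrN gtr0_norm//; lra.
have h5 : alpha / 4 <= d (alpha / 4) + d (alpha / 2).
  apply: le_trans (dD _ _).
  have -> : alpha / 2 - alpha / 4 = alpha / 4 by lra.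
  by rewrite small gtr0_norm//; lra.
have h6 : alpha / 4 <= d (- (alpha / 4)) + d (alpha / 2).
  apply: le_trans (dD _ _).
  have -> : alpha / 2 - - (alpha / 4) = 1%:~R * alpha - (alpha / 4) by lra.
  by rewrite arc_length_shift small normrN gtr0_norm//; lra.
have pa : pi < alpha / 2 by move: alpha_gt2pi; lra.
by apply: clipped_cos4_lt0; rewrite ?d0//;
  by [exact: lt_le_trans h1|exact: lt_le_trans h2|exact: lt_le_trans h3
     |exact: lt_le_trans h4|exact: lt_le_trans h5|exact: lt_le_trans h6].
Qed.

(** [G] exhibits [mean] as a function of the first coordinates alone, which reduces the claim to
    function extensionality. *)
Lemma mean_ext (P Q : probability (kale alpha) R) :
  (forall t, (folded_mean P t).1 = (folded_mean Q t).1) -> mean P = mean Q.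
Proof.
pose G (m : circle alpha -> R) : kale alpha :=
  if `[< [set t | 0 <= m t]° !=set0 /\
         forall t, [set t | 0 <= m t]° t -> 0 < m t >] then
    let t := [get t | forall s, m s <= m t] in polar (m t) t
  else origin.
move=> PQ.
change (G (fun t => (folded_mean P t).1) = G (fun t => (folded_mean Q t).1)).
by congr G; exact/funext.
Qed.

(** The left side normalizes the sum itself, the right side a chosen representative of its class;
    both have the same pulls. *)
Lemma mean_normalize_mix x y e :
  mean (normalize (measure_add (repr x) (mscale e (repr y)))) =
  class_mean (mix x y e).
Proof.
apply: mean_ext => t; rewrite [RHS]folded_mean_pull pullE.
rewrite /class_integral Rintegral_unit_mass//.
exact: (Rintegral_normalize (M1_add (repr x) (repr y) e)).
Qed.

Lemma sticky_direction_mix x y : class_sticky_direction x y ->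
  exists2 e : {nonneg R}, 0 < e%:num & class_mean (mix x y e) = class_mean x.
Proof.
move=> [e0 e0_gt0 xy]; have e20 : 0 <= e0 / 2 by rewrite divr_ge0// ltW.
exists (NngNum e20); first by rewrite divr_gt0.
rewrite -mean_normalize_mix; apply/esym/xy.
by rewrite /= divr_gt0//= ltr_pdivrMr// ltr_pMr// ltr1n.
Qed.

Lemma sticky_direction_peak_lt0 x y : peak x < 0 -> class_sticky_direction x y.
Proof.
move=> x0; set k := mass (repr x); set n := mass (repr y).
have k0 : 0 < k by exact: mass_gt0.
have n0 : 0 < n by exact: mass_gt0.
have y1 : 0 < `|peak y| + 1 by rewrite ltr_wpDl.
(* Below this threshold [e * n * (|peak y| + 1) < k * - peak x], so the mixture has negative pull in
   every direction. *)
exists (k * - peak x / (n * (`|peak y| + 1))).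
  by rewrite divr_gt0 ?mulr_gt0 ?oppr_gt0.
move=> e /andP[_ e1]; rewrite mean_normalize_mix.
rewrite -[LHS]/(class_mean x) !class_mean_origin ?(ltW x0)//.
have [t <-] := pull_peak (mix x y e); apply/ltW/pull_mix_lt0.
move: e1; rewrite ltr_pdivlMr ?mulr_gt0// mulrN -subr_lt0 opprK addrC mulrA.
apply: le_lt_trans; apply: lerD; first by rewrite ler_pM2l// peak_ge.
apply: ler_wpM2l; first by rewrite mulr_ge0// ltW.
apply: (le_trans (peak_ge alpha_gt2pi y t)).
by apply: (le_trans (ler_norm _)); rewrite lerDl.
Qed.

(** A positive peak persists on an open set. Conversely, mixing a little of a class of negative peak
    into [x] makes a nonpositive peak negative. *)
Lemma closure_peak x :
  closure [set y : M1_class alpha | peak y < 0] x <-> peak x <= 0.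
Proof.
split=> [xS|x0 B].
  rewrite leNgt; apply/negP => x0.
  have [y [/= y0]] := xS _ (open_nbhs_nbhs (conj peak_gt0_open x0)).
  by rewrite /= ltNge ltW.
rewrite nbhsE => -[W [oW Wx] WB].
have [y y0] := exists_peak_lt0.
have [e e0 We] := mix_near y oW Wx.
by exists (mix x y e); split; [exact: peak_mix_lt0|exact: WB].
Qed.

End Perturbation.

(** * The characterizations read off from the sign of the peak *)

Theorem theorem7p6 (R : realType) (alpha : R) (alpha_gt2pi : 2 * pi < alpha) :
  let S : set (M1_class alpha) := @fully_sticky_classes R alpha in
  open S /\
  forall mu : M1_class alpha,
  [/\ [/\
        S mu <-> (exists2 W : set (M1_class alpha), open_nbhs mu W &
                    forall nu, W nu -> class_mean nu = class_mean mu)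
      & S mu <-> (forall nu, class_sticky_direction mu nu)],
      [/\
        partly_sticky (unit_mass mu) <-> boundary S mu
      & partly_sticky (unit_mass mu) <->
        (forall W : set (M1_class alpha), open_nbhs mu W ->
           exists U V : set (M1_class alpha),
             [/\ open U /\ U !=set0, open V /\ V !=set0,
                 U `<=` W /\ V `<=` W,
                 forall nu, V nu -> class_mean nu = class_mean mu
               & forall nu, U nu -> class_mean nu <> class_mean mu])]
    & [/\
        nonsticky (unit_mass mu) <-> (~` closure S) mu
      & nonsticky (unit_mass mu) <->
        ~ (exists W U : set (M1_class alpha),
             [/\ open_nbhs mu W, open U, U !=set0, U `<=` W
               & forall nu, U nu -> class_mean nu = class_mean mu])]].
Proof.
move=> S.
have SE : S = [set x | peak x < 0].
  by apply/seteqP; split=> x /=; rewrite /S /fully_sticky_classes /=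
    => /(fully_stickyP alpha_gt2pi).
have oS : open S by rewrite SE; exact: peak_lt0_open.
have cS x : closure S x <-> peak x <= 0 by rewrite SE; exact: closure_peak.
have oP := peak_gt0_open alpha_gt2pi.
split=> // mu.
(* At a positive peak, a little mass at the origin would stay in [U] and yet shorten the mean. *)
have constant_mean (U : set (M1_class alpha)) x : open U -> U x ->
    (forall nu, U nu -> class_mean nu = class_mean x) -> peak x <= 0.
  move=> oU Ux Uc; rewrite leNgt; apply/negP => x0.
  have [e e0 Ue] := mix_near origin_class oU Ux.
  have := peak_mix_origin alpha_gt2pi x0 e0.
  by rewrite (peak_class_mean alpha_gt2pi x0 (Uc _ Ue)) ltxx.
have raise_peak x (W : set (M1_class alpha)) : open W -> W x -> peak x = 0 ->
    exists2 y, W y & 0 < peak y.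
  move=> oW Wx x0; have [t tE] := pull_peak x.
  have [e e0 We] := mix_near (ray_class t) oW Wx.
  by exists (mix x (ray_class t) e) => //;
    apply: peak_mix_ray => //; rewrite tE x0.
have sticky_mean (x y : M1_class alpha) :
    peak x <= 0 -> peak y <= 0 -> class_mean x = class_mean y.
  move=> x0 y0; rewrite (class_mean_origin alpha_gt2pi x0).
  by rewrite (class_mean_origin alpha_gt2pi y0).
split; split.
- split=> [Smu|[W [oW Wmu] Wc]].
    exists S; first exact: (conj oS Smu).
    by move: Smu; rewrite SE => mu0 nu nu0; apply: sticky_mean; exact: ltW.
  rewrite SE /=; have mu0 := constant_mean W mu oW Wmu Wc.
  rewrite lt_neqAle mu0 andbT; apply/eqP => mu0'.
  have [y Wy y0] := raise_peak mu W oW Wmu mu0'.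
  by apply: (class_mean_neq alpha_gt2pi _ (Wc _ Wy)); rewrite mu0.
- split=> [Smu nu|sd].
    by apply: sticky_direction_peak_lt0 => //; move: Smu; rewrite SE.
  (* The direction of a mass at the origin excludes a positive peak; the ray in a maximizing
     direction then excludes peak 0. *)
  have mu0 : peak mu <= 0.
    rewrite leNgt; apply/negP => mu0.
    have [e e0 /(peak_class_mean alpha_gt2pi mu0) muE] :=
      sticky_direction_mix alpha_gt2pi (sd origin_class).
    by have := peak_mix_origin alpha_gt2pi mu0 e0; rewrite muE ltxx.
  rewrite SE /= lt_neqAle mu0 andbT; apply/eqP => mu0'.
  have [t tE] := pull_peak mu.
  have [e e0] := sticky_direction_mix alpha_gt2pi (sd (ray_class t)).
  apply: class_mean_neq => //; rewrite mu0; apply: peak_mix_ray => //.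
  by rewrite tE mu0'.
(* As [S] is open, its boundary is the set where the peak is nonpositive but not negative. *)
- rewrite (partly_stickyP alpha_gt2pi); split=> [mu0|[/cS mu0 muS]].
    split; first by apply/cS; rewrite mu0.
    by move=> /interior_subset; rewrite SE /= mu0 ltxx.
  apply/eqP; rewrite eq_le mu0 leNgt; apply/negP => mu_lt0; apply: muS.
  by rewrite /interior; apply: open_nbhs_nbhs; split=> //; rewrite SE.
- rewrite (partly_stickyP alpha_gt2pi); split=> [mu0 W [oW Wmu]|UV].
    (* Peak 0 can be raised and lowered within [W]: positive peaks change the mean, negative ones
       keep it at the origin. *)
    exists (W `&` [set x | 0 < peak x]), (W `&` S); split.
    + split; first exact: openI.
      by have [y Wy y0] := raise_peak mu W oW Wmu mu0; exists y.
    + split; first exact: openI.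
      have /(_ _ (open_nbhs_nbhs (conj oW Wmu)))[y [Sy Wy]] : closure S mu.
        by apply/cS; rewrite mu0.
      by exists y.
    + by split; exact: subIsetl.
    + move=> nu [_]; rewrite SE /= => nu0; apply: sticky_mean; rewrite ?mu0//.
      exact: ltW.
    + by move=> nu [_ /= nu0]; apply: class_mean_neq => //; rewrite mu0 lexx.
  apply/eqP; rewrite eq_le; apply/andP; split.
    rewrite leNgt; apply/negP => mu0.
    (* At a positive peak no open [V] of constant mean can share the mean of [mu]. *)
    have [U [V [_ [oV [nu Vnu]] _ Vc _]]] := UV _ (conj oP mu0).
    have nu0 : peak nu <= 0.
      apply: (constant_mean V nu oV Vnu) => y Vy.
      by rewrite (Vc y Vy) (Vc nu Vnu).
    by move: nu0; rewrite (peak_class_mean alpha_gt2pi mu0 (Vc nu Vnu)) leNgt mu0.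
  rewrite leNgt; apply/negP => mu0.
  have Smu : S mu by rewrite SE.
  (* At a negative peak the neighborhood [S] contains no class with another mean. *)
  have [U [V [[_ [nu Unu]] _ [US _] _ Uc]]] := UV _ (conj oS Smu).
  apply: (Uc nu Unu); apply: sticky_mean; apply: ltW; last by [].
  by have := US nu Unu; rewrite SE.
- rewrite (nonstickyP alpha_gt2pi); split=> [mu0 /cS|mu0].
    by rewrite leNgt mu0.
  by rewrite ltNge; apply/negP => mu0'; apply: mu0; apply/cS.
- rewrite (nonstickyP alpha_gt2pi); split=> [mu0 [W [U [_ oU [nu Unu] _ Uc]]]|WU].
    have nu0 : peak nu <= 0.
      apply: (constant_mean U nu oU Unu) => y Uy.
      by rewrite (Uc y Uy) (Uc nu Unu).
    by move: nu0; rewrite (peak_class_mean alpha_gt2pi mu0 (Uc nu Unu)) leNgt mu0.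
  (* With a nonpositive peak [mu] has its mean at the origin, like every class in the nonempty open
     set [S]; the whole space serves as neighborhood. *)
  rewrite ltNge; apply/negP => mu0; apply: WU; exists setT, S; split.
  + by split; [exact: openT|].
  + exact: oS.
  + by have [y y0] := exists_peak_lt0 alpha_gt2pi; exists y; rewrite SE.
  + exact: subsetT.
  + by move=> nu; rewrite SE => nu0; apply: sticky_mean => //; exact: ltW.
Qed.
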